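(* Let $\mathbf X=(X_1,\dots,X_d)$ be a ML model $X_i=\bigvee_{j=1}^d b_{ji}Z_j$, $i=1,\dots,d$, with ML coefficient matrix $B=(b_{ij})_{d\times d}$ such that $\mathrm{sgn}(B)$ is the reachability matrix of some DAG. Define $$A:=\mathrm{diag}(b_{11},\dots,b_{dd}),\quad B_0:=\Big(\frac{b_{ij}}{b_{ii}}\Big)_{d\times d},\quad\text{and}\quad A_0^{\mathrm{tc}}:=B_0-\mathrm{id}_{d\times d},$$ where $\mathrm{id}_{d\times d}$ is the identity matrix. Then $\mathbf X$ is a recursive ML model if and only if the following fixed point equation holds: $$B=B\odot B_0,\quad\text{which is equivalent to}\quad B=A\vee B\odot A_0^{\mathrm{tc}}.$$
   Context: A ML (max-linear) model is a random vector $\mathbf X$ with $X_i=\bigvee_{j=1}^d b_{ji}Z_j$, $i=1,\dots,d$, where $Z_1,\dots,Z_d$ are independent non-negative random variables, each with support $\mathbb R_+=[0,\infty)$, and $B=(b_{ij})_{d\times d}$ has non-negative entries ($B$ is the ML coefficient matrix). $\mathbf X$ is a recursive ML model if there are a DAG $\mathcal D=(V,E)$ with node set $V=\{1,\dots,d\}$ and parent sets $\mathrm{pa}(i)=\{k:(k,i)\in E\}$, and positive weights $c_{ki}$, $i\in V$, $k\in\mathrm{pa}(i)\cup\{i\}$, such that, with the same noise variables $Z_1,\dots,Z_d$, $X_i=\bigvee_{k\in\mathrm{pa}(i)}c_{ki}X_k\vee c_{ii}Z_i$ for $i=1,\dots,d$ (equalities of random variables are understood almost surely). The reachability matrix of a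 DAG on $V$ has $ji$-th entry $1$ if there is a directed path from $j$ to $i$ or $j=i$, and $0$ otherwise. $\mathrm{sgn}(B)$ is the matrix with entry $1$ where $B$ has a positive entry and $0$ elsewhere. For non-negative matrices $F=(f_{ij})_{m\times n}$, $G=(g_{ij})_{n\times p}$, $F\odot G:=\big(\bigvee_{k=1}^n f_{ik}g_{kj}\big)_{m\times p}$; for matrices of equal size $\vee$ is the componentwise maximum ($\odot$ binds more strongly than $\vee$). *)

(* Defs.v *)
From HB Require Import structures.
From mathcomp Require Import all_boot all_order all_algebra.
From mathcomp Require Import all_classical all_reals all_analysis.
Set Implicit Arguments.
Unset Strict Implicit.
Unset Printing Implicit Defensive.
Import Order.TTheory GRing.Theory Num.Theory.
Import numFieldNormedType.Exports.
Local Open Scope classical_set_scope.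
Local Open Scope ring_scope.

(* A digraph on n nodes is a relation on 'I_n; e k i means that there is an
   edge from k to i, so pa(i) = [pred k | e k i]. *)

(* [cycle e c] is about closed walks, including loops [:: x] with [e x x]. *)
Definition is_dag (n : nat) (e : rel 'I_n) : Prop :=
  forall c : seq 'I_n, c != [::] -> ~~ cycle e c.

(* [connect e] is the reflexive transitive closure of e. *)
Definition reachability_mx (R : realType) (n : nat) (e : rel 'I_n) : 'M[R]_n :=
  \matrix_(j, i) (connect e j i)%:R.

Definition sgn_mx (R : realType) (m n : nat) (F : 'M[R]_(m, n)) : 'M[R]_(m, n) :=
  \matrix_(i, j) (0 < F i j)%R%:R.

(* For non-negative matrices, 0 is neutral for the maximum of the products. *)
Definition odot_mx (R : realType) (m n p : nat)
    (F : 'M[R]_(m, n)) (G : 'M[R]_(n, p)) : 'M[R]_(m, p) :=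
  \matrix_(i, j) \big[Num.max/0]_(k < n) (F i k * G k j).

Definition vee_mx (R : realType) (m n : nat) (F G : 'M[R]_(m, n)) :
    'M[R]_(m, n) :=
  map2_mx Num.max F G.

Declare Scope maxlinear_scope.
Delimit Scope maxlinear_scope with ML.
Notation "F ⊙ G" := (odot_mx F G) (at level 40, left associativity) :
  maxlinear_scope.
Notation "F ∨ G" := (vee_mx F G) (at level 50, left associativity) :
  maxlinear_scope.

Definition mutually_independent (dT : measure_display) (T : measurableType dT)
    (R : realType) (P : probability T R) (n : nat)
    (Z : 'I_n -> {RV P >-> R}) : Prop :=
  forall (J : {set 'I_n}) (A : 'I_n -> set R),
    (forall i, measurable (A i)) ->
    P (\bigcap_(i in [set` J]) (Z i @^-1` A i)) =
    (\prod_(i in J) P (Z i @^-1` A i))%E.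

Definition rv_support (dT : measure_display) (T : measurableType dT)
    (R : realType) (P : probability T R) (Y : {RV P >-> R}) : set R :=
  [set x | forall U : set R, open U -> U x -> (0 < distribution P Y U)%E].

Definition is_noise (dT : measure_display) (T : measurableType dT)
    (R : realType) (P : probability T R) (n : nat)
    (Z : 'I_n -> {RV P >-> R}) : Prop :=
  [/\ mutually_independent Z,
      forall j, {ae P, forall w, 0 <= Z j w} &
      forall j, rv_support (Z j) = [set x | 0 <= x]].

Definition is_ML_model (dT : measure_display) (T : measurableType dT)
    (R : realType) (P : probability T R) (n : nat)
    (Z : 'I_n -> {RV P >-> R}) (B : 'M[R]_n) (X : 'I_n -> {RV P >-> R}) :
    Prop :=
  [/\ is_noise Z,
      forall i j, 0 <= B i j &
      forall i, {ae P, forall w, X i w = \big[Num.max/0]_(j < n) (B j i * Z j w)}].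

(* The weight c k i is only constrained and used for k in pa(i) or k = i.
   The index 0 of the maximum over pa(i) is harmless, even if pa(i) is empty,
   since c i i * Z i is almost surely non-negative. *)
Definition is_recursive_ML_model (dT : measure_display) (T : measurableType dT)
    (R : realType) (P : probability T R) (n : nat)
    (Z : 'I_n -> {RV P >-> R}) (X : 'I_n -> {RV P >-> R}) : Prop :=
  exists (e : rel 'I_n) (c : 'I_n -> 'I_n -> R),
    [/\ is_dag e,
        forall k i, e k i || (k == i) -> 0 < c k i &
        forall i, {ae P, forall w,
          X i w = Num.max (\big[Num.max/0]_(k < n | e k i) (c k i * X k w))
                          (c i i * Z i w)}].

Definition diag_part (R : realType) (n : nat) (B : 'M[R]_n) : 'M[R]_n :=
  diag_mx (\row_i B i i).

Definition row_scaled (R : realType) (n : nat) (B : 'M[R]_n) : 'M[R]_n :=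
  \matrix_(i, j) (B i j / B i i).

(* Main.v *)
Require Import Defs.
From HB Require Import structures.
From mathcomp Require Import all_boot all_order all_algebra.
From mathcomp Require Import all_classical all_reals all_analysis.
Set Implicit Arguments.
Unset Strict Implicit.
Unset Printing Implicit Defensive.
Import Order.TTheory GRing.Theory Num.Theory.
Import numFieldNormedType.Exports.
Local Open Scope classical_set_scope.
Local Open Scope ring_scope.
Local Open Scope maxlinear_scope.

(** Write [x_i(z) = max_j B j i * z_j] for the max-linear map with matrix [B],
    so that [X = x(Z)] almost surely.  The proof compares three conditions.

    The combinatorial one: as [B k k > 0], the [(i, j)] entry of [B ⊙ B0] is
    the maximum over [k] of [B i k * B k j / B k k]; the term [k = i] is
    [B i j] itself, so the fixed point equation says exactly that
    [B i k * B k j <= B i j * B k k] for all [i, k, j]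
    ([odot_row_scaled_fixpoint]).  The matrix [A ∨ B ⊙ A0tc] always equals
    [B ⊙ B0] ([vee_odot_row_scaled]): subtracting the identity removes only the
    terms [k = j], which off the diagonal repeat the term [k = i] and on the
    diagonal are restored by [A]; the other diagonal terms
    [B i k * B k i / B k k] vanish because there are no cycles.

    The deterministic one: the recursion holds for [x(z)] at every [z >= 0].
    At the unit vector of node [j] it reads
    [B j i = max_(k in pa(i)) c k i * B j k ∨ c i i * (i == j)],
    and induction on [i] along the edges gives the combinatorial condition
    ([recursion_triangle]).  Conversely the combinatorial condition yields the
    recursion with the edges [k -> i] for [k != i] and [B k i > 0] and the
    weights [B k i / B k k] ([triangle_recursion]).

    The probabilistic one: the recursion holds almost surely at [z = Z].  By
    independence, the noise vector visits every open box around a point of the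
    orthant with positive probability, so that an almost sure identity between
    continuous functions of [Z] is an identity on the whole orthant
    ([ae_noise_eq]); hence it is equivalent to the deterministic one. *)

(** * Directed acyclic graphs *)

Section Dag.
Variables (n : nat) (e : rel 'I_n).
Hypothesis dag_e : is_dag e.

Lemma dag_connect_edge (i j : 'I_n) : connect e i j -> ~~ e j i.
Proof.
move=> /connectP[p ep ->]; apply/negP => eji.
by have := dag_e (isT : i :: p != [::]); rewrite /= rcons_path ep eji.
Qed.

Lemma dag_connect_anti : antisymmetric (connect e).
Proof.
move=> x y /andP[/connectP[[|z p] /= ep ->] // cyx].
case/andP: ep => exz ep.
have czx : connect e z x by apply: connect_trans cyx; apply/connectP; exists p.
by move: (dag_connect_edge czx); rewrite exz.
Qed.

(** A closed walk would join two distinct nodes in both directions. *)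
Lemma dag_strict_connect (e' : rel 'I_n) :
  (forall x y, e' x y -> (x != y) && connect e x y) -> is_dag e'.
Proof.
move=> e'e [//|x p] _; apply/negP => /= ep.
have [y [exy cyx]] : exists y, e' x y /\ connect e' y x.
  have lst : last x (rcons p x) = x by rewrite last_rcons.
  case Erc: (rcons p x) ep lst => [|y q] /=; first by case: p Erc.
  by move=> /andP[exy eq] lst; exists y; split=> //; apply/connectP; exists q.
have {}cyx : connect e y x.
  by apply: connect_sub cyx => u v /e'e/andP[].
case/andP: (e'e _ _ exy) => /eqP neq cxy; apply: neq.
by apply: dag_connect_anti; rewrite cxy.
Qed.

(** The number of ancestors of a node strictly increases along an edge. *)
Lemma dag_ind (Q : 'I_n -> Prop) :
  (forall i, (forall k, e k i -> Q k) -> Q i) -> forall i, Q i.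
Proof.
move=> IH i; have [m] := ubnP #|[set k | connect e k i]%SET|.
elim: m i => // m IHm i; rewrite ltnS => le_m; apply: IH => k eki; apply: IHm.
apply: leq_trans le_m.
apply: proper_card; apply/properP; split.
  apply/fintype.subsetP => l; rewrite !inE => clk.
  exact: connect_trans clk (connect1 eki).
exists i; rewrite !inE ?connect0 //.
by apply: contraTN eki => /dag_connect_edge.
Qed.

End Dag.

(** * The fixed point equation as a system of inequalities *)

Lemma mulr_bigmaxr (R : realType) (I : finType) (Q : pred I) (F : I -> R)
    (a : R) : 0 <= a ->
  a * \big[Num.max/0]_(i | Q i) F i = \big[Num.max/0]_(i | Q i) (a * F i).
Proof.
by move=> a0; apply: (big_morph _ _ (mulr0 a)) => y z; rewrite maxr_pMr.
Qed.

Section FixedPoint.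
Variables (R : realType) (n : nat) (B : 'M[R]_n).
Hypothesis B_ge0 : forall i j, 0 <= B i j.
Hypothesis B_diag : forall i, 0 < B i i.

Lemma odot_row_scaled_ge i j : B i j <= (B ⊙ row_scaled B) i j.
Proof.
rewrite mxE; apply: (bigmax_sup i) => //.
by rewrite mxE mulrCA divff ?mulr1 // gt_eqF.
Qed.

Lemma odot_row_scaled_fixpoint :
  B = B ⊙ row_scaled B <->
  (forall i k j, B i k * B k j <= B i j * B k k).
Proof.
split=> [BE i k j|tri].
  rewrite {3}BE mxE -ler_pdivrMr // -mulrA.
  by apply: (bigmax_sup k); rewrite // mxE.
apply/matrixP => i j; apply/eqP; rewrite eq_le odot_row_scaled_ge /= mxE.
by apply: bigmax_le => // k _; rewrite mxE mulrA ler_pdivrMr.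
Qed.

Lemma vee_odot_row_scaled :
  (forall i k, k != i -> B i k * B k i = 0) ->
  diag_part B ∨ (B ⊙ (row_scaled B - 1%:M)) = B ⊙ row_scaled B.
Proof.
move=> acyc; apply/matrixP => i j; apply/eqP; rewrite eq_le.
have tc k : (row_scaled B - 1%:M) k j = if k == j then 0 else B k j / B k k.
  by rewrite !mxE; case: eqP => [->|_]; rewrite ?subr0 // divff ?subrr // gt_eqF.
rewrite {1 2}/vee_mx !mxE; apply/andP; split.
  rewrite ge_max; apply/andP; split.
    apply: le_trans (_ : B i j <= _).
      by case: eqP => [->|_]; rewrite ?mulr1n ?mulr0n.
    by have := odot_row_scaled_ge i j; rewrite mxE.
  apply: le_bigmax2 => k _; apply: ler_wpM2l => //.
  by rewrite tc mxE; case: eqP => // _; rewrite divr_ge0.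
apply: bigmax_le => [|k _]; first by rewrite le_max bigmax_ge_id orbT.
rewrite mxE le_max; have [<-{j tc}|nij] := eqVneq i j.
  rewrite mulr1n; have [->|nki] := eqVneq k i.
    by rewrite divff ?gt_eqF // mulr1 lexx.
  by rewrite mulrA acyc // mul0r B_ge0.
apply/orP; right; have [->|nkj] := eqVneq k j.
  apply: (bigmax_sup i) => //.
  by rewrite tc (negPf nij) divff ?gt_eqF // mulr1 mulrCA divff ?gt_eqF ?mulr1.
by apply: (bigmax_sup k) => //; rewrite tc (negPf nkj).
Qed.

End FixedPoint.

(** * The recursion on the orthant *)

Definition maxlin (R : realType) (n : nat) (B : 'M[R]_n) (z : 'rV[R]_n)
    (i : 'I_n) : R :=
  \big[Num.max/0]_(j < n) (B j i * z 0 j).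

Definition ml_recursion (R : realType) (n : nat) (e : rel 'I_n)
    (c : 'I_n -> 'I_n -> R) (x : 'I_n -> R) (z : 'rV[R]_n) (i : 'I_n) : R :=
  Num.max (\big[Num.max/0]_(k < n | e k i) (c k i * x k)) (c i i * z 0 i).

Section Recursion.
Variables (R : realType) (n : nat) (B : 'M[R]_n).
Hypothesis B_ge0 : forall i j, 0 <= B i j.
Hypothesis B_diag : forall i, 0 < B i i.

Lemma maxlin_delta (j i : 'I_n) : maxlin B (delta_mx 0 j) i = B j i.
Proof.
apply/eqP; rewrite eq_le; apply/andP; split; last first.
  by apply: (bigmax_sup j); rewrite // mxE !eqxx mulr1.
apply: bigmax_le => // k _; rewrite mxE eqxx /=.
by case: eqP => [->|_]; rewrite ?mulr1 ?mulr0.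
Qed.

(** For a node [i] other than [k], the equation at the unit vector of [k]
    writes [B k i] as a maximum over the parents [l] of [i] of
    [c l i * B k l]; the induction hypothesis on [l] and the equation at the
    unit vector of [j] bound each term. *)
Lemma recursion_triangle (e : rel 'I_n) (c : 'I_n -> 'I_n -> R) :
  is_dag e -> (forall k i, e k i -> 0 <= c k i) ->
  (forall z : 'rV[R]_n, (forall j, 0 <= z 0 j) ->
    forall i, maxlin B z i = ml_recursion e c (maxlin B z) z i) ->
  forall j k i, B j k * B k i <= B j i * B k k.
Proof.
move=> dag_e c_ge0 rec j k.
have recB m i : B m i = Num.max (\big[Num.max/0]_(l < n | e l i) (c l i * B m l))
                                (c i i * (i == m)%:R).
  rewrite -[LHS]maxlin_delta rec => [|l]; last by rewrite mxE ler0n.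
  rewrite /ml_recursion mxE eqxx; congr Num.max.
  by apply: eq_bigr => l _; rewrite maxlin_delta.
apply: (dag_ind dag_e) => i IH; have [->//|nik] := eqVneq i k.
rewrite (recB k i) (negPf nik) mulr0 max_l ?bigmax_ge_id // mulr_bigmaxr //.
apply: bigmax_le => [|l eli]; first by rewrite mulr_ge0.
rewrite mulrCA; apply: le_trans (ler_wpM2l (c_ge0 _ _ eli) (IH l eli)) _.
rewrite mulrA ler_wpM2r // (recB j i) le_max.
by apply/orP; left; exact: (bigmax_sup l).
Qed.

(** The term [B j i * z_j] of [x_i(z)] is the own noise term of node [i] if
    [j = i], and otherwise is contributed through the edge [j -> i] by the own
    noise term of [j]. *)
Lemma triangle_recursion :
  (forall j k i, B j k * B k i <= B j i * B k k) ->
  forall z : 'rV[R]_n, (forall j, 0 <= z 0 j) ->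
  forall i, maxlin B z i =
    ml_recursion [rel k i | (k != i) && (0 < B k i)]
      (fun k i => if k == i then B i i else B k i / B k k) (maxlin B z) z i.
Proof.
move=> tri z z_ge0 i; apply/eqP; rewrite eq_le; apply/andP; split.
  apply: bigmax_le => [|j _]; rewrite /ml_recursion eqxx le_max.
    by rewrite bigmax_ge_id.
  have [->|nji] := eqVneq j i; first by rewrite lexx orbT.
  have [Bji|] := ltP 0 (B j i); last first.
    move=> Bji; have -> : B j i = 0 by apply/eqP; rewrite eq_le Bji B_ge0.
    by rewrite mul0r bigmax_ge_id.
  apply/orP; left; apply: (bigmax_sup j); first by rewrite /= nji.
  rewrite (negPf nji) -mulrA ler_wpM2l // -(ler_pM2l (B_diag j)).
  rewrite mulVKf ?gt_eqF //.
  exact: (bigmax_sup j).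
rewrite ge_max eqxx; apply/andP; split; last exact: (bigmax_sup i).
apply: bigmax_le => [|k /andP[/negPf -> _]]; first exact: bigmax_ge_id.
rewrite mulr_bigmaxr ?divr_ge0 //.
apply: bigmax_le => [|j _]; first exact: bigmax_ge_id.
apply: (bigmax_sup j) => //; rewrite mulrA ler_wpM2r //.
by rewrite mulrAC ler_pdivrMr // mulrC.
Qed.

End Recursion.

(** * Almost sure identities in the noise *)

Section Continuity.
Variables (R : realType) (n : nat).

Lemma continuous_maxlin (B : 'M[R]_n) (i : 'I_n) :
  continuous (fun z : 'rV[R]_n => maxlin B z i).
Proof.
apply: continuous_big => [|j _]; first exact: max_continuous.
by move=> z; exact: cvgMl_tmp (@coord_continuous _ _ _ _ _ z).
Qed.

Lemma continuous_ml_recursion (B : 'M[R]_n) (e : rel 'I_n)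
    (c : 'I_n -> 'I_n -> R) i :
  continuous (fun z : 'rV[R]_n => ml_recursion e c (maxlin B z) z i).
Proof.
apply: max_fun_continuous => [|z]; last first.
  by exact: cvgMl_tmp (@coord_continuous _ _ _ _ _ z).
apply: continuous_big => [|j _]; first exact: max_continuous.
by move=> z; exact: cvgMl_tmp (@continuous_maxlin B j z).
Qed.

End Continuity.

Section Noise.
Variables (R : realType) (dT : measure_display) (T : measurableType dT).
Variables (P : probability T R) (n : nat) (Z : 'I_n -> {RV P >-> R}).
Hypothesis noise_Z : is_noise Z.

Lemma noise_ge0 : {ae P, forall w, forall j, 0 <= Z j w}.
Proof. by case: noise_Z => _ Z_ge0 _; apply: filter_forall => j; exact: Z_ge0. Qed.

(** An open box around [z] has positive probability as a product of positive
    probabilities, hence meets every almost sure event. *)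
Lemma noise_dense (E : set T) (z : 'rV[R]_n) (U : set 'rV[R]_n) :
  {ae P, forall w, E w} -> (forall j, 0 <= z 0 j) -> nbhs z U ->
  exists2 w, E w & U (\row_j Z j w).
Proof.
case: noise_Z => indep _ supp aeE z_ge0 [V zV VU].
pose A j := (V 0 j)°.
have oA j : open (A j) by exact: open_interior.
have PA j : (0 < P (Z j @^-1` A j))%E.
  have : rv_support (Z j) (z 0 j) by rewrite supp; exact: z_ge0.
  by apply; [exact: oA|exact: zV].
set S := \bigcap_(j in [set` [set: 'I_n]%SET]) (Z j @^-1` A j).
have PS : (0 < P S)%E.
  rewrite indep => [|j]; last exact: measurable_realfun.open_measurable.
  by apply: (big_ind (fun x => 0 < x)%E) => // x y; exact: mule_gt0.
apply: contrapT => noE.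
have : P.-negligible S.
  apply: negligibleS aeE => w Sw Ew; apply: noE; exists w => //.
  apply: VU => i j; rewrite ord1 mxE.
  by apply: (@interior_subset _ (V 0 j)); apply: Sw; rewrite /= inE.
have mS : measurable S.
  apply: fin_bigcap_measurable => // j _.
  by apply: measurable_funPTI; exact: measurable_realfun.open_measurable.
by move=> /(measure_negligible mS) PS0; rewrite PS0 ltxx in PS.
Qed.

Lemma ae_noise_eq (F G : 'rV[R]_n -> R) : continuous F -> continuous G ->
  {ae P, forall w, F (\row_j Z j w) = G (\row_j Z j w)} <->
  (forall z : 'rV[R]_n, (forall j, 0 <= z 0 j) -> F z = G z).
Proof.
move=> cF cG; split=> [aeFG z z_ge0|FG]; last first.
  by apply: filterS noise_ge0 => w Zw; apply: FG => j; rewrite mxE.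
apply/eqP; rewrite -subr_eq0; apply: contrapT => nFG.
have zU : nbhs z (~` [set y | F y - G y = 0]).
  apply: open_nbhs_nbhs; split; last exact/eqP/negP.
  apply: closed_openC; apply: (preimage_closed _ (@closed_eq R 0)) => y _.
  exact: cvgB (cF y) (cG y).
by have [w Ew] := noise_dense aeFG z_ge0 zU; rewrite /= Ew subrr.
Qed.

End Noise.

Theorem theorem5p7 (R : realType) (dT : measure_display)
    (T : measurableType dT) (P : probability T R) (n : nat)
    (Z : 'I_n -> {RV P >-> R}) (B : 'M[R]_n) (X : 'I_n -> {RV P >-> R})
    (hX : is_ML_model Z B X)
    (hB : exists e : rel 'I_n, is_dag e /\ sgn_mx B = reachability_mx R e) :
  let A : 'M[R]_n := diag_part B in
  let B0 : 'M[R]_n := row_scaled B in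
  let A0tc : 'M[R]_n := B0 - 1%:M in
  (is_recursive_ML_model Z X <-> B = B ⊙ B0) /\
  (B = B ⊙ B0 <-> B = A ∨ (B ⊙ A0tc)).
Proof.
case: hX => noise_Z B_ge0 X_def; case: hB => e [dag_e sgnB].
have B_gt0 j i : (0 < B j i) = connect e j i.
  move/matrixP/(_ j i): sgnB; rewrite !mxE => /eqP.
  by rewrite eqr_nat; case: (0 < B j i); case: connect.
have B_diag i : 0 < B i i by rewrite B_gt0 connect0.
have acyc i k : k != i -> B i k * B k i = 0.
  move=> nki; apply/eqP; apply: contraNT nki; rewrite mulf_eq0 negb_or => nz.
  apply/eqP/(dag_connect_anti dag_e).
  by rewrite -!B_gt0 !lt0r !B_ge0 !andbT andbC.
move=> A B0 A0tc; split; last by rewrite (vee_odot_row_scaled B_ge0 B_diag acyc).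
rewrite (odot_row_scaled_fixpoint B_ge0 B_diag).
(* The recursion of X is the recursion of maxlin B at the noise vector. *)
have X_rec (e' : rel 'I_n) (c : 'I_n -> 'I_n -> R) :
    (forall i, {ae P, forall w,
       X i w = Num.max (\big[Num.max/0]_(k < n | e' k i) (c k i * X k w))
                       (c i i * Z i w)}) <->
    (forall z : 'rV[R]_n, (forall j, 0 <= z 0 j) ->
       forall i, maxlin B z i = ml_recursion e' c (maxlin B z) z i).
  have aeX : {ae P, forall w, forall i, X i w = maxlin B (\row_j Z j w) i}.
    apply: filter_forall => i; apply: filterS (X_def i) => w ->.
    by apply: eq_bigr => j _; rewrite mxE.
  have noise_rec i := ae_noise_eq noise_Z (@continuous_maxlin _ _ B i)
    (@continuous_ml_recursion _ _ B e' c i).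
  have transfer w : (forall i, X i w = maxlin B (\row_j Z j w) i) -> forall i,
      Num.max (\big[Num.max/0]_(k < n | e' k i) (c k i * X k w)) (c i i * Z i w)
      = ml_recursion e' c (maxlin B (\row_j Z j w)) (\row_j Z j w) i.
    move=> Xw i; rewrite /ml_recursion mxE; congr Num.max.
    by apply: eq_bigr => k _; rewrite Xw.
  split=> [rec z z_ge0 i|rec i].
    apply: (noise_rec i).1 => //; apply: filterS2 aeX (rec i) => w Xw.
    by rewrite transfer // Xw.
  have := (noise_rec i).2 (fun z z_ge0 => rec z z_ge0 i).
  by apply: filterS2 aeX => w Xw; rewrite transfer // Xw.
split=> [[e' [c [dag_e' c_gt0 /X_rec rec]]]|tri].
  apply: (recursion_triangle B_ge0 dag_e') rec => k i eki.
  by apply/ltW/c_gt0; rewrite eki.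
exists [rel k i | (k != i) && (0 < B k i)].
exists (fun k i => if k == i then B i i else B k i / B k k).
split; last by apply/X_rec; exact: triangle_recursion.
- by apply: (dag_strict_connect dag_e) => k i /=; rewrite B_gt0.
- move=> k i /=; case: eqP => //= _; rewrite orbF => Bki.
  by rewrite divr_gt0.
Qed.
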